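(* For every $\eta \in (0,1)$ there exist constants $C', C_\eta > 0$ depending only on $\eta$ such that, for every $p \geq 1$ and every $\mu \in \mathbb{R}^p$ with $\mu_1 \geq \dots \geq \mu_p > 0$, $$P_{\mu}\{\varphi = 1\} + \sup_{\lambda \in \Lambda(\mu, C_\eta \psi)} P_{\lambda}\{\varphi = 0\} \leq \eta,$$ where $\varphi$ is the test $$\varphi = \mathbf{1}\left\{\|X - \mu\|_\infty > \max_{1 \leq j \leq p} \mu_j h^{-1}\left(\frac{\log(C' j^2)}{\mu_j}\right)\right\}$$ and $$\psi = 1 + \max_{1 \leq j \leq p} \mu_j h^{-1}\left(\frac{\log(ej)}{\mu_j}\right).$$
   Context: $h : [-1,\infty) \to \mathbb{R}$ is defined by $h(-1) = 1$ and $h(x) = (1+x)\log(1+x) - x$ for $x > -1$; $h^{-1} : [0,\infty) \to [0,\infty)$ denotes the inverse of $h$ restricted to $[0,\infty)$. For $\lambda \in [0,\infty)^p$, $P_\lambda$ denotes the law of $X = (X_1,\dots,X_p)$ with independent coordinates $X_j \sim \mathrm{Poisson}(\lambda_j)$. For $\varepsilon > 0$, $\Lambda(\mu,\varepsilon) = \{\lambda \in [0,\infty)^p : \|\mu - \lambda\|_\infty \geq \varepsilon\}$, where $\|v\|_\infty = \max_{1 \leq j \leq p}|v_j|$. *)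

(* Defs.v *)
From HB Require Import structures.
From mathcomp Require Import all_boot all_order all_algebra.
From mathcomp Require Import all_classical all_reals all_analysis.
From mathcomp Require Import ring.

Set Implicit Arguments.
Unset Strict Implicit.
Unset Printing Implicit Defensive.

Import Order.TTheory GRing.Theory Num.Theory.
Import numFieldNormedType.Exports.

Local Open Scope classical_set_scope.
Local Open Scope ring_scope.

(* Only the values on [-1, +oo[ are meaningful. *)
Definition h {R : realType} (x : R) : R :=
  if x == -1 then 1 else (1 + x) * ln (1 + x) - x.

(* Only the values on [0, +oo[ are meaningful; see [h_bij] below. *)
Definition hinv {R : realType} : R -> R := pinv (`[0, +oo[ : set R) h.

(* The law on nat^p of independent X_j ~ Poisson(lambda_j): the mass of a
   point k is the product of the P(X_j = k_j).  The second argument of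
   [poisson_prob] is unused by that definition; [poisson_prob] is the Dirac mass
   at 0 for a null rate, whereas [poisson_pmf] is not meaningful there. *)
Definition poisson_law {R : realType} (p : nat) (lambda : 'rV[R]_p)
    (A : set (p.-tuple nat)) : \bar R :=
  \esum_(k in A)
    (\prod_(j < p) poisson_prob (lambda 0 j)%R 0%N [set tnth k j])%E.

Definition obs {R : realType} (p : nat) (k : p.-tuple nat) : 'rV[R]_p :=
  \row_j (tnth k j)%:R.

(* The index j : 'I_p stands for j.+1; for 1 <= C' the terms are nonnegative and 0
   is a harmless unit for the maximum. *)
Definition threshold {R : realType} (C' : R) (p : nat) (mu : 'rV[R]_p) : R :=
  \big[Num.max/0]_(j < p)
    (mu 0 j * hinv (ln (C' * j.+1%:R ^+ 2) / mu 0 j)).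

(* On row vectors `|_| is the sup norm. *)
Definition phi {R : realType} (C' : R) (p : nat) (mu : 'rV[R]_p)
    (x : 'rV[R]_p) : bool :=
  threshold C' mu < `|x - mu|.

Definition psi {R : realType} (p : nat) (mu : 'rV[R]_p) : R :=
  1 + \big[Num.max/0]_(j < p)
    (mu 0 j * hinv (ln (expR 1 * j.+1%:R) / mu 0 j)).

Definition Lambda {R : realType} (p : nat) (mu : 'rV[R]_p) (eps : R) :
    set 'rV[R]_p :=
  [set lambda : 'rV[R]_p | (forall j, 0 <= lambda 0 j) /\ eps <= `|mu - lambda|].

Section h_theory.
Context {R : realType}.

Let hE (x : R) : 0 <= x -> h x = (1 + x) * ln (1 + x) - x.
Proof.
move=> x0; rewrite /h ifF//; apply/negbTE; rewrite gt_eqF//.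
by rewrite (lt_le_trans _ x0)// ltrN10.
Qed.

Let g (x : R) := (1 + x) * ln (1 + x) - x.

Let dg (x : R) : 0 <= x -> is_derive x 1 g (ln (1 + x)).
Proof.
move=> x0; have x1 : 0 < 1 + x by rewrite ltr_pwDl.
have d1 : is_derive x 1 (fun y : R => 1 + y) 1.
  have := is_deriveD (is_derive_cst (1 : R) x 1) (is_derive_id x (1 : R)).
  by rewrite add0r.
have d2 : is_derive x 1 (fun y : R => ln (1 + y)) ((1 + x)^-1).
  have := @is_derive1_comp R (@ln R) (fun y => 1 + y) x _ _
    (is_derive1_ln x1) d1.
  by rewrite mulr1.
have := is_deriveB (is_deriveM d1 d2) (is_derive_id x (1 : R)).
move=> /is_derive_eq; apply.
by rewrite /GRing.scale/= mulr1 mulfV ?gt_eqF// [X in X - _]addrC addrK.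
Qed.

Let cg (x : R) : 0 <= x -> {for x, continuous g}.
Proof.
move=> /dg dgx; apply: differentiable_continuous.
by apply/derivable1_diffP; exact: ex_derive.
Qed.

Let cgw (a b : R) : 0 <= a -> {within `[a, b], continuous g}.
Proof.
move=> a0; apply: continuous_in_subspaceT => x.
by rewrite inE/= in_itv/= => /andP[ax _]; apply: cg; exact: le_trans ax.
Qed.

Let g_incr (x y : R) : 0 <= x -> x < y -> g x < g y.
Proof.
move=> x0 xy.
have dgi z : z \in `]x, y[%R -> is_derive z 1 g (ln (1 + z)).
  by rewrite in_itv/= => /andP[xz _]; apply: dg; exact/ltW/(le_lt_trans x0).
have [c] := MVT xy dgi (cgw x0).
rewrite in_itv/= => /andP[xc _] E.
rewrite -subr_gt0 E mulr_gt0 ?subr_gt0// ln_gt0// ltrDl.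
exact: le_lt_trans xc.
Qed.

Let g_ge (v : R) : 0 <= v -> exists2 b, 0 <= b & v <= g b.
Proof.
move=> v0; have v2 : 0 <= 2 + v by rewrite addr_ge0.
have e1 : 1 <= expR (2 + v) by rewrite (le_trans _ (expR_ge1Dx _))// lerDl.
exists (expR (2 + v) - 1); first by rewrite subr_ge0.
rewrite /g addrCA subrr addr0 expRK.
have -> : expR (2 + v) * (2 + v) - (expR (2 + v) - 1)
   = expR (2 + v) * (1 + v) + 1.
  by ring.
rewrite (@le_trans _ _ (1 * (1 + v)))//; first by rewrite mul1r lerDr.
by rewrite (@le_trans _ _ (expR (2 + v) * (1 + v)))// ?lerDl// ler_wpM2r ?addr_ge0.
Qed.

Lemma h_bij : set_bij `[0, +oo[ `[0, +oo[ (@h R).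
Proof.
have g0 : g 0 = 0 by rewrite /g addr0 ln1 mulr0 subrr.
split.
- move=> x /=; rewrite !in_itv/= !andbT => x0; rewrite hE// -/(g x) -g0.
  by move: x0; rewrite le_eqVlt => /predU1P[<-//|x0]; exact/ltW/g_incr.
- move=> x y; rewrite !inE/= !in_itv/= !andbT => x0 y0.
  rewrite !hE// -/(g x) -/(g y) => xy.
  have [xy'|xy'|//] := ltgtP x y.
  + by have := g_incr x0 xy'; rewrite xy ltxx.
  + by have := g_incr y0 xy'; rewrite xy ltxx.
- move=> v /=; rewrite in_itv/= andbT => v0.
  have [b b0 vb] := g_ge v0.
  have [|c] := @IVT R g 0 b v b0 (cgw (lexx 0)).
    by rewrite g0 ge_min le_max v0 vb/= orbT.
  rewrite in_itv/= => /andP[c0 _] gc.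
  by exists c; rewrite /= ?in_itv/= ?c0// hE.
Qed.

Lemma hinv_bij : set_bij `[0, +oo[ `[0, +oo[ (@hinv R).
Proof. exact: (bijpinv_bij (fun=> point) h_bij). Qed.

Lemma hinvK (y : R) : 0 <= y -> h (hinv y) = y.
Proof.
move=> y0; have [_ _ hs] := h_bij.
by apply: (surjpK _ hs); rewrite inE/= in_itv/= y0.
Qed.

Lemma hK (x : R) : 0 <= x -> hinv (h x) = x.
Proof.
move=> x0; have [_ hi _] := h_bij.
by apply: (pinvKV _ hi); rewrite inE/= in_itv/= x0.
Qed.

End h_theory.

Section poisson_law_theory.
Context {R : realType}.
Local Open Scope ereal_scope.

Let esumZl (T : choiceType) (A : set T) (a : T -> \bar R) (c : \bar R) :
  c \is a fin_num -> 0 <= c -> (forall i, 0 <= a i) ->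
  \esum_(i in A) (c * a i) = c * \esum_(i in A) a i.
Proof.
move=> /fineK <-; move: (fine c) => r; rewrite lee_fin => r0 a0.
rewrite /esum -ereal_supZl//; last first.
  by apply/set0P; exists (\sum_(x \in set0) a x), set0 => //; exact: fsets_set0.
congr ereal_sup; apply/seteqP; split => [_ [X XA <-]|_ [_ [X XA <-] <-]] /=.
  by exists (\sum_(x \in X) a x); [exists X|rewrite ge0_mule_fsumr].
by exists X => //; rewrite ge0_mule_fsumr.
Qed.

Let esum_box (p : nat) (f : 'I_p -> nat -> \bar R) (A : 'I_p -> set nat) :
  (forall j n, 0 <= f j n) -> (forall j n, f j n \is a fin_num) ->
  (forall j, \esum_(n in A j) f j n \is a fin_num) ->
  \esum_(k in [set k : p.-tuple nat | forall j, A j (tnth k j)])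
    \prod_(j < p) f j (tnth k j) =
  \prod_(j < p) \esum_(n in A j) f j n.
Proof.
elim: p => [|p IH] in f A *; move=> f0 ffin Afin.
  rewrite (_ : [set _ | _] = [set [tuple] : 0.-tuple nat]); last first.
    apply/seteqP; split => [k _ /=|k _ []//]; exact: tuple0.
  by rewrite esum_set1 !big_ord0.
pose B := [set k : p.-tuple nat | forall j, A (lift ord0 j) (tnth k j)].
pose e (z : nat * p.-tuple nat) : p.+1.-tuple nat := [tuple of z.1 :: z.2].
rewrite (reindex_esum (A ord0 `*`` fun=> B) _ e); last first.
  split.
  - move=> [n t] /= [An Bt] j; have [j' ->|->] := unliftP ord0 j.
      by rewrite tnthS; exact: Bt.
    by rewrite tnth0.
  - move=> [n t] [n' t'] _ _ /(congr1 val)/= [-> tt'].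
    by congr pair; exact: val_inj.
  - move=> k; rewrite (tuple_eta k) => Ak.
    exists (thead k, [tuple of behead k]) => //=; split => [|j] /=.
      by have := Ak ord0; rewrite tnth0.
    by have := Ak (lift ord0 j); rewrite tnthS.
under eq_esum => z _.
  rewrite big_ord_recl tnth0.
  under eq_bigr do rewrite tnthS.
  over.
rewrite -(esum_esum (J := fun=> B) (a := fun n (t : p.-tuple nat) =>
   f ord0 n * \prod_(j < p) f (lift ord0 j) (tnth t j))); last first.
  by move=> n t _ _; rewrite mule_ge0// prode_ge0.
rewrite big_ord_recl.
under eq_esum => n _.
  rewrite esumZl//; last by move=> t; rewrite prode_ge0.
  rewrite (IH (fun j => f (lift ord0 j)) (fun j => A (lift ord0 j)))//.
  over.
under eq_esum do rewrite muleC.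
rewrite esumZl//; first exact: muleC.
- by apply: prode_fin_num => j _.
- by apply: prode_ge0 => j _; exact: esum_ge0.
Qed.

Let esum_set1_prob (P : probability nat R) (A : set nat) :
  \esum_(n in A) P [set n] = P A.
Proof.
have {2}-> : A = \bigcup_(n in A) [set n].
  by apply/seteqP; split => [n An|_ [n An ->]//]; exists n.
rewrite measure_bigcup//; last by move=> i j _ _ [x [-> ->]].
by rewrite nneseries_esum// set_mem_set.
Qed.

(* The coordinates are independent, the j-th one being Poisson(lambda_j). *)
Lemma poisson_law_box (p : nat) (lambda : 'rV[R]_p) (A : 'I_p -> set nat) :
  poisson_law lambda [set k | forall j, A j (tnth k j)] =
  \prod_(j < p) poisson_prob (lambda 0%R j) 0%N (A j).
Proof.
rewrite /poisson_law.
rewrite (@esum_box p (fun j n => poisson_prob (lambda 0%R j) 0%N [set n]) A).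
- by apply: eq_bigr => j _; rewrite esum_set1_prob.
- by move=> j n; exact: measure_ge0.
- by move=> j n; exact: fin_num_measure.
- by move=> j; rewrite esum_set1_prob; exact: fin_num_measure.
Qed.

Section probability.
Variables (p : nat) (lambda : 'rV[R]_p).

Let mass_ge0 (k : p.-tuple nat) :
  0 <= \prod_(j < p) poisson_prob (lambda 0%R j) 0%N [set tnth k j].
Proof. by apply: prode_ge0 => j _; exact: measure_ge0. Qed.

Let poisson_law0 : poisson_law lambda set0 = 0.
Proof. exact: esum_set0. Qed.

Let poisson_law_ge0 A : 0 <= poisson_law lambda A.
Proof. by apply: esum_ge0 => k _; exact: mass_ge0. Qed.

Let poisson_law_sigma_additive : semi_sigma_additive (poisson_law lambda).
Proof.
move=> F mF tF mUF; apply: cvg_toP.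
  apply: ereal_nondecreasing_is_cvgn => a b ab.
  by apply: lee_sum_nneg_natr => // n _ _; exact: poisson_law_ge0.
by rewrite /poisson_law nneseries_sum_bigcup.
Qed.

HB.instance Definition _ := isMeasure.Build _ _ _ (poisson_law lambda)
  poisson_law0 poisson_law_ge0 poisson_law_sigma_additive.

Let poisson_law_setT : poisson_law lambda [set: p.-tuple nat] = 1.
Proof.
rewrite (_ : setT = [set k | forall j, setT (tnth k j)]); last first.
  by apply/seteqP; split.
rewrite (@poisson_law_box p lambda (fun=> setT)).
by rewrite big1// => j _; exact: probability_setT.
Qed.

HB.instance Definition _ := Measure_isProbability.Build _ _ _
  (poisson_law lambda) poisson_law_setT.

End probability.

End poisson_law_theory.

(* Main.v *)
Require Import Defs.
From mathcomp Require Import all_boot all_order all_algebra.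
From mathcomp Require Import all_classical all_reals all_analysis.
From mathcomp Require Import ring lra.

Set Implicit Arguments.
Unset Strict Implicit.
Unset Printing Implicit Defensive.

Import Order.TTheory GRing.Theory Num.Theory.
Import numFieldNormedType.Exports.

Local Open Scope classical_set_scope.
Local Open Scope ring_scope.

(** Everything rests on one exponential inequality for a single coordinate: for
X ~ Poisson(rate), both tails at distance [rate * x] are at most
[expR (- rate * h x)] ([poisson_deviation]).  The upper tail is the Chernoff
bound with exponent [t = ln (1 + x)].  For the lower tail the optimal
exponent leads to the larger rate [h (- x)] and makes sense for [x < 1] only; the
opposite exponent [- ln (1 + x)] already gives [h x], for all [x], and this comes
down to [t <= sinh t].

First error.  The [j]-th term of the threshold is calibrated so that the
[j]-th coordinate exceeds it with probability at most
[2 * expR (- ln (C' * j ^+ 2)) = 2 / (C' * j ^+ 2)].  A union bound and the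
convergence of the sum of the inverse squares give [4 / C'].

Second error.  If [lambda] is far from [mu], then
[d = `|mu_j - lambda_j| >= Ceta * psi] for some [j], and a single coordinate
suffices.  Convexity of [h] gives [hinv (a * y) <= a * hinv y] for [1 <= a],
and [ln (C' * j ^+ 2) <= (2 + ln C') * ln (e * j)], hence the threshold is below
[(2 + ln C') * psi] ([threshold_lt_psi]), which is at most [d / 2] for [Ceta] large.
Acceptance therefore forces [X_j] to deviate from its mean [lambda_j] by more
than [d / 2], and a Chebyshev-type bound ([poisson_quadratic_tail]) controls this by a
multiple of [(lambda_j + d) / d ^+ 2].  Here [lambda_j <= mu_j + d], and
[h x <= x ^+ 2] yields [mu_j <= psi ^+ 2] ([mean_le_psi_sqr]), which leaves
[O (1 / Ceta)].  The quadratic bound itself is the exponential inequality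
weakened by [h x >= x ^+ 2 / (4 * (1 + x))] and [expR (- u) <= u^-1]. *)

(** * The rate function and its inverse *)

Section rate_function.
Context {R : realType}.
Implicit Types (x y a : R).

Lemma hE x : 0 <= x -> h x = (1 + x) * ln (1 + x) - x.
Proof. by move=> x0; rewrite /h ifF//; apply/negbTE; rewrite gt_eqF//; lra. Qed.

Lemma h0 : h (0 : R) = 0.
Proof. by rewrite hE// addr0 ln1 mulr0 subrr. Qed.

Lemma ln_le_subr1 x : 0 < x -> ln x <= x - 1.
Proof.
by move=> x0; have := @le_ln1Dx R (x - 1); rewrite (addrC 1) subrK; apply; lra.
Qed.

(** The graph of the convex function [h] lies above its tangents, the slope of
[h] being [ln (1 + x)].  Rearranged, this is [ln (u / v) <= u / v - 1] with
[u = 1 + x] and [v = 1 + y].  Strict monotonicity and [h_scale] both follow from it. *)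
Lemma h_tangent x y : 0 <= x -> 0 <= y -> h x + ln (1 + x) * (y - x) <= h y.
Proof.
move=> x0 y0; rewrite !hE//.
have x1 : 0 < 1 + x by lra.
have y1 : 0 < 1 + y by lra.
have := ln_le_subr1 (divr_gt0 x1 y1).
rewrite ln_div ?posrE// => /(ler_wpM2l (ltW y1)).
rewrite [leRHS](_ : _ = x - y); last by field; lra.
by nra.
Qed.

Lemma h_strict_incr x y : 0 <= x -> x < y -> h x < h y.
Proof.
move=> x0 xy; have y0 : 0 <= y by lra.
have := h_tangent x0 y0.
(* The tangent at [0] is horizontal: strictness is then gained at [y / 2]. *)
have [->|xn0] := eqVneq x 0.
  rewrite h0 => _.
  have z0 : 0 <= y / 2 by lra.
  have l0 : 0 < ln (1 + y / 2) by apply: ln_gt0; lra.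
  have := h_tangent z0 y0; have := h_tangent (lexx 0) z0.
  by rewrite h0 addr0 ln1; nra.
have l0 : 0 < ln (1 + x).
  by apply: ln_gt0; rewrite ltrDl lt_def xn0.
by nra.
Qed.

Lemma h_mono : {in Num.nneg &, {mono (@h R) : x y / x <= y}}.
Proof.
apply: le_mono_in => x y; rewrite !nnegrE => x0 _; exact: h_strict_incr.
Qed.

Lemma hinv_ge0 y : 0 <= y -> 0 <= hinv y.
Proof.
move=> y0; have [hf _ _] := @hinv_bij R.
by have := hf y; rewrite /= !in_itv/= !andbT; apply.
Qed.

Lemma hinv_le x y : 0 <= x -> 0 <= y -> (hinv y <= x) = (y <= h x).
Proof.
by move=> x0 y0; rewrite -h_mono ?nnegrE ?hinv_ge0// hinvK.
Qed.

Lemma hinv_ge x y : 0 <= x -> 0 <= y -> (x <= hinv y) = (h x <= y).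
Proof.
by move=> x0 y0; rewrite -h_mono ?nnegrE ?hinv_ge0// hinvK.
Qed.

(** By convexity and [h 0 = 0]: combine the tangent at [x] evaluated at [0] with
the same tangent evaluated at [a * x]. *)
Lemma h_scale a x : 1 <= a -> 0 <= x -> a * h x <= h (a * x).
Proof.
move=> a1 x0; have ax0 : 0 <= a * x by nra.
have := h_tangent x0 ax0; have := h_tangent x0 (lexx 0).
by rewrite h0; nra.
Qed.

(** The concavity of [hinv], in the form used to compare two logarithmic levels:
a level multiplied by at most [a] multiplies the quantile by at most [a]. *)
Lemma hinv_scale a y z : 1 <= a -> 0 <= y -> 0 <= z -> z <= a * y ->
  hinv z <= a * hinv y.
Proof.
move=> a1 y0 z0 zy; have hy0 := hinv_ge0 y0.
rewrite hinv_le//; last by nra.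
by apply: (le_trans zy); rewrite -{1}(hinvK y0) h_scale.
Qed.

Lemma h_le_sqr x : 0 <= x -> h x <= x ^+ 2.
Proof.
move=> x0; rewrite hE//.
have := @le_ln1Dx R x; rewrite (lt_le_trans _ x0)// => /(_ isT); nra.
Qed.

Lemma sqrt_le_hinv y : 0 <= y -> Num.sqrt y <= hinv y.
Proof.
move=> y0; rewrite hinv_ge ?sqrtr_ge0//.
by rewrite -[leRHS](sqr_sqrtr y0) h_le_sqr// sqrtr_ge0.
Qed.

(** With [s = Num.sqrt (1 + x)], the bound [ln s >= 1 - s^-1] gives
[h x >= (s - 1) ^+ 2], and [x = (s - 1) * (s + 1)] where [s + 1 <= 2 * s]. *)
Lemma h_ge x : 0 <= x -> x ^+ 2 / (4 * (1 + x)) <= h x.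
Proof.
move=> x0; rewrite hE//.
have x1 : 0 <= 1 + x by lra.
set s := Num.sqrt (1 + x).
have ss : 1 + x = s ^+ 2 by rewrite sqr_sqrtr.
have s0 : 0 < s by rewrite sqrtr_gt0; lra.
have s1 : 1 <= s by nra.
have xE : x = s ^+ 2 - 1 by lra.
have sV : 0 < s^-1 by rewrite invr_gt0.
have := ln_le_subr1 sV; rewrite lnV ?posrE// => ls.
rewrite ss xE lnXn// -[_ *+ 2]mulr_natr.
apply: (@le_trans _ _ ((s - 1) ^+ 2)).
  rewrite ler_pdivrMr; last by nra.
  rewrite [leLHS](_ : _ = (s - 1) ^+ 2 * (s + 1) ^+ 2); last by ring.
  by apply: ler_wpM2l; [exact: sqr_ge0|nra].
have ls2 : s ^+ 2 * (1 - s^-1) <= s ^+ 2 * ln s.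
  by apply: ler_wpM2l; [exact: sqr_ge0|lra].
have E : s ^+ 2 * (1 - s^-1) = s ^+ 2 - s by field; lra.
by rewrite E in ls2; nra.
Qed.

(** The difference vanishes at [0], and its derivative
[expR u + expR (- u) - 2] is nonnegative since the two exponentials have product [1]. *)
Lemma ler_sinh (t : R) : 0 <= t -> 2 * t <= expR t - expR (- t).
Proof.
move=> t0; rewrite -subr_ge0.
pose f (u : R) := expR u - expR (- u) - 2 * u.
have df (u : R) : is_derive u 1 f (expR u + expR (- u) - 2).
  apply: is_derive_eq.
  by rewrite /GRing.scale/=; ring.
have f0 : f 0 = 0 by rewrite /f oppr0 mulr0 !subrr.
rewrite -/(f t) -f0.
apply: (@ger0_derive1_ndecry R f 0) => //.
  move=> u _; rewrite derive1E derive_val.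
  have E : expR u * expR (- u) = 1 by rewrite -expRD subrr expR0.
  have := expR_gt0 u; have := sqr_ge0 (expR u - 1); nra.
apply: continuous_subspaceT => u.
apply: differentiable_continuous; apply/derivable1_diffP; exact: ex_derive.
Qed.

(** The Chernoff exponent, per unit of rate, of the event [X <= rate * (1 - x)] at
the parameter [- ln (1 + x)]; once [h] is
expanded and like terms cancel, the inequality is [ler_sinh] at [ln (1 + x)]. *)
Lemma lower_tail_exponent_le x : 0 <= x ->
  expR (- ln (1 + x)) - 1 + (1 - x) * ln (1 + x) <= - h x.
Proof.
move=> x0; have x1 : 1 <= 1 + x by lra.
have := ler_sinh (ln_ge0 x1); rewrite lnK ?posrE; last by lra.
by rewrite hE//; nra.
Qed.

Lemma expRN_le_inv (u : R) : 0 < u -> expR (- u) <= u^-1.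
Proof.
move=> u0; rewrite expRN lef_pV2 ?posrE ?expR_gt0//.
have := expR_ge1Dx u; lra.
Qed.

(** Telescoping: [((m + 1) ^+ 2)^-1 <= m^-1 - (m + 1)^-1], so the sum stays below
[2 - n%:R^-1]. *)
Lemma sum_inv_sqr_le2 n : \sum_(j < n) (j.+1%:R ^+ 2)^-1 <= 2 :> R.
Proof.
apply: (@le_trans _ _ (2 - n%:R^-1)); last by rewrite gerBl invr_ge0.
elim: n => [|n ih]; first by rewrite big_ord0 invr0; lra.
(* The first term is apart: [0^-1 = 0] breaks the telescoping bound at [m = 0]. *)
rewrite big_ord_recr/=; case: n => [|n] in ih *.
  by rewrite big_ord0 expr1n; lra.
apply: (le_trans (lerD ih (lexx _))).
set m : R := n.+1%:R; have m0 : 0 < m by rewrite ltr0n.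
have -> : n.+2%:R = m + 1 :> R by rewrite -natr1.
rewrite -subr_ge0 [leRHS](_ : _ = (m * (m + 1) ^+ 2)^-1).
  by rewrite invr_ge0; nra.
by field; lra.
Qed.

End rate_function.

(** * Tails of one Poisson variable *)

Section poisson_tails.
Context {R : realType}.
Implicit Types (rate s t b x : R) (A : set nat) (k : nat).

(** Exponential tilting maps the Poisson family to itself.  It replaces the
computation of the moment generating function in the Chernoff bound below. *)
Lemma poisson_pmf_tilt rate t k : 0 < rate ->
  poisson_pmf rate k =
  expR (rate * (expR t - 1) - t * k%:R) * poisson_pmf (rate * expR t) k.
Proof.
move=> r0; have e0 := expR_gt0 t.
rewrite /poisson_pmf r0 (mulr_gt0 r0 e0) exprMn -expRM_natl.
have -> : - rate = rate * (expR t - 1) - t * k%:R + k%:R * t - rate * expR t.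
  by ring.
by rewrite !expRD; ring.
Qed.

(** On [A] the tilting density is at most the stated constant, and the
tilted law has total mass [1]. *)
Lemma poisson_chernoff rate t b A : 0 < rate ->
  (forall k, A k -> b <= t * k%:R) ->
  (poisson_prob rate 0 A <= (expR (rate * (expR t - 1) - b))%:E)%E.
Proof.
move=> r0 Ab; set c := expR (_ - b).
have rt0 : 0 < rate * expR t by rewrite mulr_gt0 ?expR_gt0.
have <- : (c%:E * poisson_prob (rate * expR t) 0 setT = c%:E)%E.
  by rewrite probability_setT mule1.
rewrite /poisson_prob r0 rt0 -nneseries_esumT; last first.
  by move=> n; rewrite lee_fin poisson_pmf_ge0.
rewrite -nneseriesZl; last by move=> n _; rewrite lee_fin poisson_pmf_ge0.
rewrite nneseries_esumT; last first.
  by move=> n; rewrite lee_fin mulr_ge0 ?expR_ge0 ?poisson_pmf_ge0.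
rewrite esum_mkcond; apply: le_esum => k _; case: ifPn => [|_]; last first.
  by rewrite lee_fin mulr_ge0 ?expR_ge0 ?poisson_pmf_ge0.
rewrite inE => /Ab btk; rewrite lee_fin (poisson_pmf_tilt t)//.
by rewrite ler_wpM2r ?poisson_pmf_ge0// ler_expR lerB.
Qed.

(** The Chernoff bound at the parameters [ln (1 + x)] and [- ln (1 + x)]; the first
is optimal for the upper tail, the second is only good enough for the lower one. *)
Lemma poisson_deviation rate x : 0 < rate -> 0 <= x ->
  (poisson_prob rate 0 [set k | (rate * x < `|k%:R - rate|)%R] <=
   (2 * expR (- (rate * h x)))%:E)%E.
Proof.
move=> r0 x0; have x1 : 0 < 1 + x by lra.
have l0 : 0 <= ln (1 + x) by apply: ln_ge0; lra.
pose U := [set k | rate * (1 + x) < k%:R].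
pose L := [set k | k%:R < rate * (1 - x)].
have -> : [set k | rate * x < `|k%:R - rate|] = U `|` L.
  apply/seteqP; split=> k; rewrite /U /L/= ltr_normr.
    by case/orP => ?; [left|right]; lra.
  by case=> ?; apply/orP; [left|right]; lra.
have PU : (poisson_prob rate 0 U <= (expR (- (rate * h x)))%:E)%E.
  have := @poisson_chernoff rate (ln (1 + x)) (rate * (1 + x) * ln (1 + x)) U r0.
  rewrite lnK ?posrE// (_ : _ - _ = - (rate * h x)); last by rewrite hE//; ring.
  by apply=> k Uk; rewrite mulrC ler_wpM2l// ltW.
have PL : (poisson_prob rate 0 L <= (expR (- (rate * h x)))%:E)%E.
  have /le_trans : (poisson_prob rate 0 L <= (expR (rate *
      (expR (- ln (1 + x)) - 1) - - (rate * (1 - x) * ln (1 + x))))%:E)%E.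
    apply: poisson_chernoff => // k Lk.
    by rewrite mulNr lerN2 mulrC ler_wpM2r// ltW.
  apply; rewrite lee_fin ler_expR.
  by have /(ler_wpM2l (ltW r0)) := lower_tail_exponent_le x0; nra.
apply: (le_trans (measureU2 _ _ _)) => //.
by rewrite mulr_natl mulr2n EFinD leeD.
Qed.

(** A substitute for Chebyshev's inequality, deduced from the exponential bound so
that no variance is needed; at rate [0] the variable is constant. *)
Lemma poisson_quadratic_tail rate s : 0 <= rate -> 0 < s ->
  (poisson_prob rate 0 [set k | (s < `|k%:R - rate|)%R] <=
   (8 * (rate + s) / s ^+ 2)%:E)%E.
Proof.
rewrite le_eqVlt => /predU1P[<- s0|r0 s0].
  rewrite /poisson_prob ltxx diracE memNset/=.
    by rewrite lee_fin divr_ge0 ?sqr_ge0//; lra.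
  by rewrite subr0 normr0; lra.
have sr0 : 0 < s / rate by rewrite divr_gt0.
have := poisson_deviation r0 (ltW sr0).
rewrite mulrCA divff ?gt_eqF// mulr1 => /le_trans; apply.
rewrite lee_fin.
have q : s ^+ 2 / (4 * (rate + s)) <= rate * h (s / rate).
  apply: le_trans (ler_wpM2l (ltW r0) (h_ge (ltW sr0))).
  by rewrite le_eqVlt; apply/orP; left; apply/eqP; field; lra.
have q0 : 0 < s ^+ 2 / (4 * (rate + s)).
  by rewrite divr_gt0 ?exprn_gt0//; lra.
apply: (@le_trans _ _ (2 * expR (- (s ^+ 2 / (4 * (rate + s)))))).
  by rewrite ler_wpM2l// ler_expR lerN2.
apply: (le_trans (ler_wpM2l _ (expRN_le_inv q0))) => //.
by rewrite le_eqVlt; apply/orP; left; apply/eqP; field; lra.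
Qed.

End poisson_tails.

(** * Independent Poisson vectors and the sup norm *)

Section poisson_vectors.
Context {R : realType}.

Lemma poisson_law_coord p (lambda : 'rV[R]_p) j (B : set nat) :
  poisson_law lambda [set k | B (tnth k j)] = poisson_prob (lambda 0 j) 0 B.
Proof.
rewrite (_ : [set k | _] =
  [set k | forall i, (if i == j then B else setT) (tnth k i)]); last first.
  apply/seteqP; split => k /=; last by move/(_ j); rewrite eqxx.
  by move=> Bk i; case: eqP => [->|].
rewrite (poisson_law_box lambda (fun i => if i == j then B else setT)).
rewrite (bigD1 j)//= eqxx big1 ?mule1// => i /negbTE ->.
exact: probability_setT.
Qed.

(** Taking [P] to be all coordinates gives the union bound, and taking [P] to be
a single one bounds an event by a marginal of the law. *)
Lemma poisson_law_union_bound p (lambda : 'rV[R]_p) (P : pred 'I_p)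
    (A : set (p.-tuple nat)) (B : 'I_p -> set nat) :
  (forall k, A k -> exists2 j, P j & B j (tnth k j)) ->
  (poisson_law lambda A <= \sum_(j | P j) poisson_prob (lambda 0%R j) 0%N (B j))%E.
Proof.
move=> AB; under eq_bigr do rewrite -poisson_law_coord.
rewrite /poisson_law; under eq_bigr do rewrite esum_mkcond.
have m0 k : (0 <= \prod_(j < p) poisson_prob (lambda 0%R j) 0%N [set tnth k j])%E.
  by apply: prode_ge0 => j _; exact: measure_ge0.
have i0 k j : (0 <= if k \in [set k | B j (tnth k j)] then
    \prod_(j < p) poisson_prob (lambda 0%R j) 0%N [set tnth k j] else 0)%E.
  by case: ifP.
rewrite -esum_sum// [leLHS]esum_mkcond; apply: le_esum => k _.
case: ifPn => [|_]; last exact: sume_ge0.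
rewrite inE => /AB[j Pj Bj]; rewrite [leRHS](bigD1 j)//= ifT ?inE//.
by rewrite leeDl// sume_ge0.
Qed.

Lemma row_norm_attained p (v : 'rV[R]_p) : 0 < `|v| ->
  exists j, `|v| = `|v 0 j|.
Proof.
move=> v0; have [|[i j]] := @mx_norm_neq0 R 1 p v; first by rewrite gt_eqF.
by rewrite (ord1 i) => E; exists j.
Qed.

Lemma row_norm_coord p (v : 'rV[R]_p) j : `|v 0 j| <= `|v|.
Proof.
rewrite [leRHS]mx_normrE.
exact: (le_bigmax _ (fun ij : 'I_1 * 'I_p => `|v ij.1 ij.2|) (0, j)).
Qed.

End poisson_vectors.

(** * The two errors of the test *)

Section test.
Context {R : realType}.
Context (p : nat) (mu : 'rV[R]_p) (mu0 : forall j, 0 < mu 0 j).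

Lemma threshold_ge0 C : 0 <= threshold C mu.
Proof. exact: bigmax_ge_id. Qed.

Lemma type1_error C : 1 <= C ->
  (poisson_law mu [set k | phi C mu (obs k) = true] <= (4 / C)%:E)%E.
Proof.
move=> C1; have C0 : 0 < C by lra.
have ln0 (j : 'I_p) : 0 <= ln (C * j.+1%:R ^+ 2).
  by apply: ln_ge0; rewrite mulr_ege1// exprn_ege1// ler1n.
pose y (j : 'I_p) := ln (C * j.+1%:R ^+ 2) / mu 0 j.
have y0 j : 0 <= y j by rewrite divr_ge0// ltW.
pose B j := [set k | mu 0 j * hinv (y j) < `|k%:R - mu 0 j|].
apply: (@le_trans _ _ (\sum_j poisson_prob (mu 0%R j) 0%N (B j))%E).
  apply: poisson_law_union_bound => k /= tk.
  have [|j Ej] := @row_norm_attained _ _ (obs k - mu).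
    exact: le_lt_trans (threshold_ge0 C) tk.
  exists j => //; rewrite /B/=; move: tk; rewrite /phi Ej !mxE; apply: le_lt_trans.
  exact: (le_bigmax 0 (fun j => mu 0 j * hinv (y j))).
apply: (@le_trans _ _ (\sum_(j < p) (2 / C * (j.+1%:R ^+ 2)^-1)%:E)%E).
  apply: lee_sum => j _.
  apply: (le_trans (poisson_deviation (mu0 j) (hinv_ge0 (y0 j)))).
  rewrite hinvK// mulrCA divff ?gt_eqF// mulr1 lee_fin.
  rewrite expRN lnK ?posrE ?mulr_gt0 ?exprn_gt0//.
  by rewrite invfM mulrA.
rewrite sumEFin lee_fin -mulr_sumr.
apply: (le_trans (ler_wpM2l _ (sum_inv_sqr_le2 p))); first by rewrite divr_ge0// ltW.
by rewrite le_eqVlt; apply/orP; left; apply/eqP; field; lra.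
Qed.

Let q (j : 'I_p) := ln (expR 1 * j.+1%:R) / mu 0 j.

Let ln_ge1 (j : 'I_p) : 1 <= ln (expR 1 * j.+1%:R : R).
Proof.
by rewrite lnM ?posrE ?expR_gt0// expRK lerDl ln_ge0// ler1n.
Qed.

Let q_ge j : (mu 0 j)^-1 <= q j.
Proof. by rewrite ler_peMl// invr_ge0 ltW. Qed.

Let q_ge0 j : 0 <= q j.
Proof. by apply: le_trans (q_ge j); rewrite invr_ge0 ltW. Qed.

Let psi_ge j : 1 + mu 0 j * hinv (q j) <= psi mu.
Proof.
by rewrite lerD2l; exact: (le_bigmax 0 (fun j => mu 0 j * hinv (q j))).
Qed.

Lemma psi_ge1 : 1 <= psi mu.
Proof. by rewrite lerDl; exact: bigmax_ge_id. Qed.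

(** The comparison constant comes from
[ln (C * j ^+ 2) = ln C + 2 * ln j <= (2 + ln C) * (1 + ln j)]. *)
Lemma threshold_lt_psi C : 1 <= C -> threshold C mu < (2 + ln C) * psi mu.
Proof.
move=> C1; set a := 2 + ln C.
have lC : 0 <= ln C by exact: ln_ge0.
have a2 : 2 <= a by rewrite lerDl.
apply: (@le_lt_trans _ _ (a * (psi mu - 1))); last by nra.
have p1 := psi_ge1.
apply: bigmax_le => [|j _]; first by nra.
apply: (@le_trans _ _ (a * (mu 0 j * hinv (q j)))); last first.
  by rewrite ler_wpM2l//; [lra|have := psi_ge j; lra].
rewrite [leRHS]mulrCA ler_wpM2l ?(ltW (mu0 _))//.
have lj : 0 <= ln j.+1%:R :> R by rewrite ln_ge0// ler1n.
apply: hinv_scale => //; first lra.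
- by rewrite divr_ge0 ?(ltW (mu0 _))// ln_ge0// mulr_ege1// exprn_ege1// ler1n.
- rewrite /q mulrA ler_wpM2r ?invr_ge0 ?(ltW (mu0 _))//.
  have j0 : 0 < j.+1%:R :> R by [].
  have -> : ln (C * j.+1%:R ^+ 2) = ln C + 2 * ln j.+1%:R.
    by rewrite lnM ?lnXn ?mulr_natl ?posrE ?exprn_gt0//; lra.
  by rewrite lnM ?expRK ?posrE ?expR_gt0// /a; nra.
Qed.

(** Since [ln (e * j) >= 1] and [hinv y >= Num.sqrt y], the [j]-th term of [psi] is
at least [mu_j * Num.sqrt (mu_j^-1) = Num.sqrt mu_j]. *)
Lemma mean_le_psi_sqr j : mu 0 j <= psi mu ^+ 2.
Proof.
have mj := mu0 j.
have [s0 sE] : 0 <= Num.sqrt (mu 0 j) /\ Num.sqrt (mu 0 j) ^+ 2 = mu 0 j.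
  by rewrite sqrtr_ge0 sqr_sqrtr// ltW.
set s := Num.sqrt _ in s0 sE.
suff : s <= psi mu by move=> sp; rewrite -sE lerXn2r ?nnegrE//; have := psi_ge1; lra.
apply: le_trans (psi_ge j); rewrite -[leLHS]add0r lerD//.
have {1}-> : s = mu 0 j * Num.sqrt (mu 0 j)^-1.
  have sn : s != 0 by rewrite gt_eqF// sqrtr_gt0.
  by rewrite sqrtrV ?ltW// -/s -sE; field.
rewrite ler_wpM2l ?(ltW (mu0 _))//; apply: le_trans (sqrt_le_hinv (q_ge0 j)).
by rewrite ler_wsqrtr.
Qed.

(** With [d >= D * psi] and [s = d / 2], the quadratic tail is at most
[32 * (psi ^+ 2 + d + d / 2) / d ^+ 2 <= 32 / D + 48 / D]. *)
Lemma type2_error C D (lambda : 'rV[R]_p) : 1 <= C -> 1 <= D ->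
  2 * (2 + ln C) <= D -> Lambda mu (D * psi mu) lambda ->
  (poisson_law lambda [set k | phi C mu (obs k) = false] <= (80 / D)%:E)%E.
Proof.
move=> C1 D1 CD [l0 dl]; have ps1 := psi_ge1.
have [|j Ej] := @row_norm_attained _ _ (mu - lambda).
  by apply: lt_le_trans dl; nra.
move: dl; rewrite {}Ej !mxE; set d := `|_| => dl.
have d1 : D <= d by nra.
have d0 : 0 < d by lra.
apply: (@le_trans _ _ (\sum_(i | i == j) poisson_prob (lambda 0%R i) 0%N
    [set k | (d / 2 < `|k%:R - lambda 0 i|)%R])%E).
  apply: (@poisson_law_union_bound _ _ lambda (pred1 j) _
    (fun i => [set k | d / 2 < `|k%:R - lambda 0 i|])) => k /= /negbT.
  rewrite -leNgt => kt; exists j => //.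
  have := threshold_lt_psi C1; have := row_norm_coord (obs k - mu) j.
  rewrite !mxE; have := ler_distD (tnth k j)%:R (mu 0 j) (lambda 0 j).
  rewrite -/d [`|mu 0 j - (tnth k j)%:R|]distrC.
  nra.
rewrite big_pred1_eq.
have d20 : 0 < d / 2 by lra.
apply: (le_trans (poisson_quadratic_tail (l0 j) d20)).
have lm : lambda 0 j <= psi mu ^+ 2 + d.
  have := mean_le_psi_sqr j.
  have := ler_norm (lambda 0 j - mu 0 j); rewrite distrC -/d; lra.
rewrite lee_fin ler_pdivrMr ?exprn_gt0// mulrAC ler_pdivlMr; last by lra.
have p2 : D * psi mu ^+ 2 <= d ^+ 2.
  have : (D * psi mu) ^+ 2 <= d ^+ 2 by rewrite lerXn2r ?nnegrE//; nra.
  by apply: le_trans; rewrite exprMn; apply: ler_wpM2r; [exact: sqr_ge0|nra].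
nra.
Qed.

End test.

Theorem theorem1 (R : realType) (eta : R) (eta01 : 0 < eta < 1) :
  exists C' Ceta : R, [/\ 0 < C', 1 <= C', 0 < Ceta &
    forall (p : nat) (mu : 'rV[R]_p), (1 <= p)%N ->
      (forall i j : 'I_p, (i <= j)%N -> mu 0 j <= mu 0 i) ->
      (forall j : 'I_p, 0 < mu 0 j) ->
      (poisson_law mu [set k | phi C' mu (obs k) = true] +
       ereal_sup [set poisson_law lambda [set k | phi C' mu (obs k) = false] |
                  lambda in Lambda mu (Ceta * psi mu)] <= eta%:E)%E].
Proof.
have /andP[e0 e1] := eta01.
(* Each error gets [eta / 2]: [4 / C' = eta / 2], and [80 / Ceta <= eta / 2] thanks
   to the term [160 / eta]; the other term of [Ceta] serves the threshold. *)
have C1 : 1 <= 8 / eta by rewrite ler_pdivlMr//; lra.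
have lC : 0 <= ln (8 / eta) by exact: ln_ge0.
have D160 : 0 < 160 / eta by rewrite divr_gt0.
exists (8 / eta), (2 * (2 + ln (8 / eta)) + 160 / eta).
set D := _ + 160 / eta; have D1 : 1 <= D by rewrite /D; lra.
split=> //; [lra|lra|move=> p mu _ _ mu0].
have -> : (eta%:E = (4 / (8 / eta))%:E + (eta / 2)%:E)%E.
  by rewrite -EFinD; congr EFin; field; lra.
apply: leeD; first exact: type1_error.
apply: ge_ereal_sup => _ [lambda Ll <-].
apply: (le_trans (type2_error mu0 C1 D1 _ Ll)); first by rewrite /D; lra.
rewrite lee_fin ler_pdivrMr; last by lra.
have : 80 = eta / 2 * (160 / eta) by field; lra.
rewrite /D; nra.
Qed.
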